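(* Assume that $\sim$ is an equivalence relation on $\mathcal W$, that the homogeneous Martin kernel $k_{\hom}$ exists, and that for every $w\in\mathcal W$ at least one of the following holds: $m(w)=m(\tilde w)$ for all $\tilde w\sim w$; or $w^-\sim(\tilde w)^-$ for all $\tilde w\sim w$. Then for all $v,w\in\mathcal W$ $$k(v,w)=\begin{cases}k_{\hom}(v,w)\,\dfrac{R(v)\,N^{-|v|}}{\sum_{\hat v\sim v}m(\hat v)},& v\neq w,\\[2ex] \dfrac1{m(v)},& v=w.\end{cases}$$
   Context: Setting: $\{S_1,\dots,S_N\}$ is a finite family of similitudes $S_i:D\to D$, $D\subseteq\mathbb R^d$, with ratios $0<c_i<1$, and $K$ is its attractor (the unique non-empty compact set with $K=\bigcup_{i=1}^N S_i(K)$). $K$ is assumed connected, and the open set condition holds: there is a non-empty bounded open set $\mathcal O\subset\mathbb R^d$ with $\bigcup_i S_i(\mathcal O)\subset\mathcal O$, the union being disjoint. Words: $\mathcal A=\{1,\dots,N\}$; $\mathcal W=\bigcup_{n\ge1}\mathcal A^n\cup\{\emptyset\}$ is the set of finite words, $\emptyset$ the empty word. For $w=w_1\cdots w_n$: $|w|=n$ ($|\emptyset|=0$), $w^-=w_1\cdots w_{n-1}$ (parent, for $n\ge1$), $S_w=S_{w_1}\circ\cdots\circ S_{w_n}$, $S_\emptyset=\mathrm{id}$. Juxtaposition $vw$ is concatenation. Relation: $v\sim w$ iff $v=w$, or $|v|=|w|$, $S_v(K)\cap S_w(K)\ne\emptyset$ and $v^-\ne w^-$. $R(w)=\#\{v\in\mathcal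 W:v\sim w\}$. Mass distribution: $m:\mathcal A\to(0,1)$ with $\sum_{a\in\mathcal A}m(a)=1$, extended by $m(\emptyset)=1$ and $m(w_1\cdots w_n)=m(w_1)\cdots m(w_n)$. Transition probability on $\mathcal W$: $p(v,w)=\dfrac{m(w)}{\sum_{\hat v\sim v}m(\hat v)}$ if $w=\hat v i$ for some $\hat v\sim v$, $i\in\mathcal A$, and $p(v,w)=0$ otherwise. $p_0(v,w)=\delta_v(w)$ (Kronecker delta), $p_n(v,w)=\sum_{u\in\mathcal W}p_{n-1}(v,u)p(u,w)$ for $n\ge1$. Green function $g(v,w)=\sum_{n\ge0}p_n(v,w)$. Martin kernel $k(v,w)=g(v,w)/g(\emptyset,w)$. Homogeneous case: $k_{\hom}$ is the Martin kernel constructed in the same way, with the same $\sim$, from the uniform mass distribution $m(a)=1/N$ for all $a\in\mathcal A$. *)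

(* Defs.v *)
From HB Require Import structures.
From mathcomp Require Import all_boot all_order all_algebra.
From mathcomp Require Import finmap.
From mathcomp Require Import all_classical all_reals all_analysis.
Set Implicit Arguments.
Unset Strict Implicit.
Unset Printing Implicit Defensive.
Import Order.TTheory GRing.Theory Num.Theory.
Import numFieldNormedType.Exports.
Local Open Scope classical_set_scope.
Local Open Scope ring_scope.

Section IteratedFunctionSystem.
Context {R : realType} {d N : nat}.
Implicit Types (D K : set 'rV[R]_d) (S : 'I_N -> 'rV[R]_d -> 'rV[R]_d).

(* The library norm on row vectors is the sup norm; it induces the same
   topology and bounded sets, but not the same similitudes. *)
Definition enorm (x : 'rV[R]_d) : R := Num.sqrt (\sum_(j < d) x 0 j ^+ 2).

Definition similitude_on D (r : R) (f : 'rV[R]_d -> 'rV[R]_d) : Prop :=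
  {in D &, forall x y, enorm (f x - f y) = r * enorm (x - y)}.

Definition ifs D (c : 'I_N -> R) S : Prop :=
  forall i, [/\ 0 < c i < 1, S i @` D `<=` D & similitude_on D (c i) (S i)].

Definition self_similar D S K : Prop :=
  [/\ K !=set0, compact K, K `<=` D & K = \bigcup_(i in [set: 'I_N]) S i @` K].

Definition attractor D S K : Prop :=
  self_similar D S K /\ forall K', self_similar D S K' -> K' = K.

(* The open set need not be contained in D; the maps applied to it are then
   similitudes extending those of D, whence the third clause (which is part of
   [ifs] when the open set is contained in D). *)
Definition open_set_condition D (c : 'I_N -> R) S : Prop :=
  exists O : set 'rV[R]_d,
    [/\ O !=set0,
        open O /\ (exists M, forall x, O x -> enorm x <= M),
        forall i, similitude_on (D `|` O) (c i) (S i),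
        \bigcup_(i in [set: 'I_N]) S i @` O `<=` O
      & trivIset [set: 'I_N] (fun i => S i @` O)].

(* S_w = S_(w_1) \o ... \o S_(w_n) *)
Definition Sword S (w : seq 'I_N) : 'rV[R]_d -> 'rV[R]_d :=
  foldr (fun i f => S i \o f) id w.

(* w^-, with the junk value [::] at the empty word; [sim] does not depend on
   this value. *)
Definition parent (w : seq 'I_N) : seq 'I_N := take (size w).-1 w.

Definition sim S K : rel (seq 'I_N) := fun v w =>
  (v == w) ||
  [&& size v == size w,
      `[< (Sword S v @` K) `&` (Sword S w @` K) !=set0 >]
    & parent v != parent w].

End IteratedFunctionSystem.

(* Everything below depends on the iterated function system only through the
   relation [e] on words, to be instantiated by [sim S K]. The finitely
   supported sums and [fset_set] have junk values on infinite sets, which is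
   harmless as words related by [sim S K] have the same length. *)
Section MartinKernel.
Context {R : realType} {N : nat}.
Variables (e : rel (seq 'I_N)) (m : 'I_N -> R).
Local Notation W := (seq 'I_N).

Definition mass_distribution : Prop :=
  (forall a, 0 < m a < 1) /\ \sum_(a < N) m a = 1.

Definition nb_sim (w : W) : nat := #|` fset_set [set v | e v w]|.

Definition mass (w : W) : R := \prod_(a <- w) m a.

Definition class_mass (v : W) : R := \sum_(u \in [set u | e u v]) mass u.

Definition trans (v w : W) : R :=
  if `[< exists u i, e u v /\ w = rcons u i >] then mass w / class_mass v
  else 0.

Fixpoint trans_iter (n : nat) (v w : W) : \bar R :=
  if n is n'.+1
  then (\esum_(u in [set: W]) (trans_iter n' v u * (trans u w)%:E))%E
  else ((v == w)%:R)%:E.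

Definition green (v w : W) : \bar R :=
  (\sum_(0 <= n <oo) trans_iter n v w)%E.

(* Extended-real division, with x / 0 = +oo for x > 0 and x / +oo = 0. As
   green w w >= 1, the value martin_kernel w w is finite and nonzero only if
   green w w is finite and green [::] w lies in ]0, +oo[. *)
Definition martin_kernel (v w : W) : \bar R :=
  (green v w / green [::] w)%E.

Definition martin_kernel_exists : Prop :=
  forall v w, green v w \is a fin_num /\ green [::] w != 0%E.

End MartinKernel.

Definition uniform_mass (R : realType) (N : nat) : 'I_N -> R :=
  fun=> N%:R^-1.

(* Main.v *)
Require Import Defs.
From HB Require Import structures.
From mathcomp Require Import all_boot all_order all_algebra.
From mathcomp Require Import all_classical all_reals all_analysis.
From mathcomp Require Import zify ring.
Set Implicit Arguments.
Unset Strict Implicit.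
Unset Printing Implicit Defensive.
Import Order.TTheory GRing.Theory Num.Theory.
Import numFieldNormedType.Exports.
Local Open Scope classical_set_scope.
Local Open Scope ring_scope.

(** The chain moves down one level of the word tree at each step, so the Green
    function g(v, w) has at most one nonzero term, that of index |w| - |v|.
    For n >= 0, the probabilities factor as
<<
      p_(n+1)(v, w) = F_n(v, w) * m(w) / m(class of v),
>>
    where F_n ([class_walk]) satisfies a recursion in which m enters only
    through weighted means: F_0(v, w) is 1 or 0 according to whether w^- ~ v,
    and F_(n+1)(v, w) is the m-weighted mean of F_n(v, .) over the class of
    w^- ([trans_iterS]). It is here that ~ has to be an equivalence relation:
    every u ~ w^- moves to w with the same probability, because the masses of
    the classes of u and w^- agree.

    Started from the empty word, F is a mean of ones, so F_n is 1 on the words of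
    length n + 1 and g(empty, w) = m(w) ([green_nil]). The factor m(w) therefore cancels in the
    Martin kernel, leaving k(v, w) = F_n(v, w) / m(class of v)
    ([martin_kernel_below]).

    The alternative assumed at each word makes F_n the same for m and for the
    uniform distribution ([class_walk_indep]). If m is constant on the class of
    x, both weighted means over this class are the unweighted one. If instead
    the parents of the words u ~ x are all equivalent, then F_n(v, .) is
    constant on the class of x, as it sees u only through the class of u^-, and
    every mean returns that constant. The two kernels hence differ by the ratio
    of the two masses of the class of v, and the uniform mass of that class is
    R(v) N^(-|v|). *)

(** * Words *)

Section Words.
Context {N : nat}.
Local Notation W := (seq 'I_N).

Lemma finite_words_size n : finite_set [set w : W | size w = n].
Proof.
apply: (sub_finite_set _ (finite_image (@tval n 'I_N) (@finite_finset _ setT))).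
by move=> w /= /eqP wn; exists (Tuple wn).
Qed.

Lemma size_parent (w : W) : size (parent w) = (size w).-1.
Proof. by rewrite /parent size_takel// leq_pred. Qed.

Lemma parent_rcons (w : W) i : parent (rcons w i) = w.
Proof. by rewrite /parent size_rcons -cats1 take_size_cat. Qed.

End Words.

(** * Masses of equivalence classes *)

(** The Martin kernel is treated for an arbitrary equivalence of words that
    preserves their length; this also makes every class finite. *)
Section Kernel.
Context {R : realType} {N : nat} (e : rel (seq 'I_N)).
Local Notation W := (seq 'I_N).
Implicit Types (m : 'I_N -> R) (f : W -> R) (v w x : W).
Hypothesis e_equiv : equivalence_rel e.
Hypothesis e_size : forall v w, e v w -> size v = size w.

Let e_refl x : e x x. Proof. by case: (e_equiv x x x). Qed.

Let e_sym x y : e x y = e y x.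
Proof.
have imp a b : e a b -> e b a.
  by move=> eab; case: (e_equiv a b a) => _ /(_ eab) <-.
by apply/idP/idP; apply: imp.
Qed.

Let e_right x y z : e y z -> e x y = e x z.
Proof.
by move=> eyz; case: (e_equiv y z x) => _ /(_ eyz); rewrite !(e_sym x).
Qed.

Lemma finite_class x : finite_set [set u | e u x].
Proof.
by apply: (sub_finite_set _ (finite_words_size (size x))) => u /= /e_size.
Qed.

Lemma eq_class x y : e x y -> [set u | e u x] = [set u | e u y].
Proof. by move=> exy; apply/seteqP; split => u /=; rewrite (e_right _ exy). Qed.

Lemma class_nil : [set u | e u [::]] = [set [::]].
Proof.
apply/seteqP; split => u /=; last by move=> ->.
by move=> /e_size /size0nil.
Qed.

Lemma class_massE m x y : e x y -> class_mass e m x = class_mass e m y.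
Proof. by move=> exy; rewrite /class_mass (eq_class exy). Qed.

Lemma mass_gt0 m w : (forall a, 0 < m a) -> 0 < mass m w.
Proof. by move=> m0; apply: prodr_gt0. Qed.

Lemma mass_ge0 m w : (forall a, 0 < m a) -> 0 <= mass m w.
Proof. by move=> m0; exact/ltW/mass_gt0. Qed.

Lemma class_mass_gt0 m x : (forall a, 0 < m a) -> 0 < class_mass e m x.
Proof.
move=> m0; rewrite /class_mass (fsbigD1 x)//=; last exact: finite_class.
rewrite ltr_pwDl ?mass_gt0//.
by apply: fsumr_ge0 => u _; exact: mass_ge0.
Qed.

Lemma class_mass_ge0 m x : (forall a, 0 < m a) -> 0 <= class_mass e m x.
Proof. by move=> m0; exact/ltW/class_mass_gt0. Qed.

Lemma class_mass_nil m : class_mass e m [::] = 1.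
Proof. by rewrite /class_mass class_nil fsbig_set1 /mass big_nil. Qed.

Lemma mass_uniform w : mass (@uniform_mass R N) w = N%:R ^- size w.
Proof.
by rewrite /mass /uniform_mass big_const_seq count_predT iter_mulr_1 exprVn.
Qed.

Lemma class_mass_uniform v :
  class_mass e (@uniform_mass R N) v = (nb_sim e v)%:R * N%:R ^- size v.
Proof.
rewrite /class_mass (eq_fsbigr (fun=> N%:R ^- size v)).
  rewrite fsbig_finite; last exact: finite_class.
  by rewrite /= big_const_seq count_predT iter_addr_0 mulr_natl.
by move=> u /set_mem /= /e_size euv; rewrite mass_uniform euv.
Qed.

(** * Weighted means over a class *)

Definition class_avg m f x : R :=
  (\sum_(u \in [set u | e u x]) f u * mass m u) / class_mass e m x.

Lemma class_avg_eq m f g x :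
  (forall u, e u x -> f u = g u) -> class_avg m f x = class_avg m g x.
Proof.
move=> fg; congr (_ / _); apply: eq_fsbigr => u /set_mem /= eux.
by rewrite fg.
Qed.

Lemma class_avg_class m f x y : e x y -> class_avg m f x = class_avg m f y.
Proof. by move=> exy; rewrite /class_avg (class_massE m exy) (eq_class exy). Qed.

Lemma class_avg_const m a f x : (forall b, 0 < m b) ->
  (forall u, e u x -> f u = a) -> class_avg m f x = a.
Proof.
move=> m0 fa; rewrite (class_avg_eq m (g := fun=> a)) // /class_avg.
by rewrite -mulr_fsumr -/(class_mass e m x) mulfK// gt_eqF ?class_mass_gt0.
Qed.

Lemma class_avg_ge0 m f x : (forall a, 0 < m a) ->
  (forall u, 0 <= f u) -> 0 <= class_avg m f x.
Proof.
move=> m0 f0; rewrite divr_ge0 ?class_mass_ge0//.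
by apply: fsumr_ge0 => u _; rewrite mulr_ge0 ?f0 ?mass_ge0.
Qed.

(** A weighted mean is unchanged when all the weights are rescaled; in
    particular two mass distributions that are both constant on a class give
    the same mean over it. *)
Lemma class_avg_proportional m m' k f x : k != 0 ->
  (forall u, e u x -> mass m' u = k * mass m u) ->
  class_avg m' f x = class_avg m f x.
Proof.
move=> k0 mm'; rewrite /class_avg.
have -> : class_mass e m' x = k * class_mass e m x.
  by rewrite /class_mass mulr_fsumr; apply: eq_fsbigr => u /set_mem /mm'.
rewrite (eq_fsbigr (fun u => k * (f u * mass m u))).
  by rewrite -mulr_fsumr -mulf_div divff// mul1r.
by move=> u /set_mem /mm' ->; rewrite mulrCA.
Qed.

(** * The part of the transition probabilities that is blind to masses *)

(** This is p_(n+1)(v, w) stripped of its obvious dependence on m, namely of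
    the factor m(w) / m(class of v). The index is shifted by one because p_0,
    the Kronecker delta, does not have this form. The test at the empty word
    discards its junk parent, the empty word itself. *)
Fixpoint class_walk m n v w : R :=
  if n is n'.+1 then class_avg m (class_walk m n' v) (parent w)
  else ((w != [::]) && e v (parent w))%:R.

Lemma class_walk_ge0 m n v w : (forall a, 0 < m a) -> 0 <= class_walk m n v w.
Proof.
by move=> m0; elim: n w => [|n IHn] w /=; [rewrite ler0n | apply: class_avg_ge0].
Qed.

Lemma class_walk_size m n v w : (forall a, 0 < m a) ->
  size w != (size v + n).+1 -> class_walk m n v w = 0.
Proof.
move=> m0; elim: n w => [|n IHn] w /= wn.
  case: (boolP (_ && _)) => // /andP[].
  case: w wn => // a w; rewrite addn0 eqSS => wn _ /e_size.
  by rewrite size_parent /= => vw; rewrite vw eqxx in wn.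
apply: class_avg_const => // u /e_size; rewrite size_parent => uw.
by apply: IHn; rewrite uw; lia.
Qed.

(** The empty word is alone in its class and every one-letter word has it as
    its parent; higher up, means of ones are ones. *)
Lemma class_walk_nil m n w : (forall a, 0 < m a) ->
  size w = n.+1 -> class_walk m n [::] w = 1.
Proof.
move=> m0; elim: n w => [|n IHn] w /= wn.
  case: w wn => // a w [] w0.
  by rewrite [parent _]size0nil ?e_refl// size_parent.
by apply: class_avg_const => // u /e_size; rewrite size_parent wn => /IHn.
Qed.

(** Both clauses of the recursion see the endpoint only through the class of
    its parent, and through its being empty or not. *)
Lemma class_walk_parent m n v u w : e u w -> e (parent u) (parent w) ->
  class_walk m n v u = class_walk m n v w.
Proof.
move=> /e_size uw epuw; case: n => [|n] /=; last exact: class_avg_class.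
by rewrite (e_right v epuw) -!size_eq0 uw.
Qed.

(** Each step of the recursion is a mean over one class: in the first case the
    two systems of weights on it are proportional, in the second the averaged
    function is constant on it. *)
Lemma class_walk_indep m m' n v w :
  (forall a, 0 < m a) -> (forall a, 0 < m' a) ->
  (forall x, (exists2 k, k != 0 & forall u, e u x -> mass m' u = k * mass m u)
    \/ (forall u, e u x -> e (parent u) (parent x))) ->
  class_walk m' n v w = class_walk m n v w.
Proof.
move=> m0 m'0 alt; elim: n w => //= n IHn w.
rewrite (class_avg_eq m' (g := class_walk m n v)) => [|u _]; last exact: IHn.
have [[k k0 mm']|par] := alt (parent w); first exact: class_avg_proportional mm'.
by rewrite !(class_avg_const (a := class_walk m n v (parent w)))// => u euw;
  apply: class_walk_parent; rewrite ?par.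
Qed.

(** * Transition probabilities *)

Lemma trans_rcons m u x i :
  trans e m u (rcons x i) =
  if e u x then mass m (rcons x i) / class_mass e m x else 0.
Proof.
rewrite /trans; case: asboolP => [[y [j [eyu /rcons_inj[-> _]]]]|nex].
  by rewrite e_sym eyu (class_massE m eyu).
by case: ifPn => // eux; exfalso; apply: nex; exists x, i; rewrite e_sym.
Qed.

Lemma trans_nil m u : trans e m u [::] = 0.
Proof.
rewrite /trans; case: asboolP => // -[y [j [_ /(congr1 size)]]].
by rewrite size_rcons.
Qed.

(** One step of the chain backwards in time: the words leading to w are those
    equivalent to its parent, and they all do so with the same probability
    because the mass of their common class is the same. *)
Lemma esum_trans m f w : (forall a, 0 < m a) -> (forall u, 0 <= f u) ->
  (\esum_(u in [set: W]) ((f u)%:E * (trans e m u w)%:E))%E =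
  (if w == [::] then 0
   else (\sum_(u \in [set u | e u (parent w)]) f u)
        * (mass m w / class_mass e m (parent w)))%:E.
Proof.
move=> m0 f0; case/lastP: w => [|x i].
  by rewrite eqxx esum1// => u _; rewrite trans_nil mule0.
rewrite -size_eq0 size_rcons /= parent_rcons.
set r := mass m _ / _.
have r0 : 0 <= r by rewrite divr_ge0 ?mass_ge0 ?class_mass_ge0.
have -> : (\esum_(u in [set: W]) ((f u)%:E * (trans e m u (rcons x i))%:E))%E
    = (\esum_(u in [set u | e u x]) (f u * r)%:E)%E.
  rewrite [RHS]esum_mkcond; apply: eq_esum => u _.
  rewrite trans_rcons; case: ifPn => [eux|/negP neux].
    by rewrite mem_set// EFinM.
  by rewrite memNset// mule0.
rewrite esum_fset; [|exact: finite_class|by move=> u _; rewrite lee_fin mulr_ge0].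
by rewrite !(fsbig_finite _ _ (finite_class x)) sumEFin mulr_suml.
Qed.

Lemma fsum_delta v x :
  \sum_(u \in [set u | e u x]) ((v == u)%:R : R) = (e v x)%:R.
Proof.
have [ev|nev] := boolP (e v x).
  rewrite (fsbigD1 v)//=; last exact: finite_class.
  rewrite eqxx fsbig1 ?addr0// => u [_ /= /eqP].
  by rewrite eq_sym => /negbTE ->.
apply: fsbig1 => u /= eu; case: eqVneq => // vu.
by rewrite vu eu in nev.
Qed.

(** The factor m(u) carried by the words u reached after n steps provides the
    weights of the mean over the class of w^-, and the probability
    m(w) / m(class of w^-) of the last step provides its denominator. *)
Lemma trans_iterS m n v w : (forall a, 0 < m a) ->
  trans_iter e m n.+1 v w =
  (class_walk m n v w * mass m w / class_mass e m v)%:E.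
Proof.
move=> m0; have cm0 x : class_mass e m x != 0 by rewrite gt_eqF ?class_mass_gt0.
elim: n w => [|n IHn] w.
  rewrite [trans_iter _ _ _ _ _]/= esum_trans//=.
  case: eqVneq => [_|w0] /=; first by rewrite !mul0r.
  rewrite fsum_delta.
  case: (boolP (e v (parent w))) => [ev|_]; last by rewrite !mul0r.
  by rewrite (class_massE m ev) mulrA.
rewrite [LHS]/= (eq_esum (b := fun u =>
  ((class_walk m n v u * mass m u / class_mass e m v)%:E
   * (trans e m u w)%:E)%E)); last by move=> u _; rewrite -/(trans_iter e m n.+1 v u) IHn.
rewrite esum_trans// => [|u]; last first.
  by rewrite divr_ge0 ?mulr_ge0 ?class_walk_ge0 ?mass_ge0 ?class_mass_ge0.
case: eqVneq => [->|w0].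
  by rewrite class_walk_size// !mul0r.
by rewrite -mulr_fsuml /= /class_avg; congr (_%:E); field; rewrite !cm0.
Qed.

Lemma trans_iter_size m n v w : (forall a, 0 < m a) ->
  size w != (size v + n)%N -> trans_iter e m n v w = 0%E.
Proof.
move=> m0; case: n => [|n] wn.
  by rewrite /=; case: eqVneq => // vw; rewrite vw addn0 eqxx in wn.
by rewrite trans_iterS// class_walk_size ?mul0r// -addnS.
Qed.

Lemma trans_iter_ge0 m n v w : (forall a, 0 < m a) ->
  (0 <= trans_iter e m n v w)%E.
Proof.
move=> m0; case: n => [|n]; first by rewrite lee_fin ler0n.
rewrite trans_iterS// lee_fin.
by rewrite divr_ge0 ?mulr_ge0 ?class_walk_ge0 ?mass_ge0 ?class_mass_ge0.
Qed.

(** * Green function and Martin kernel *)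

Lemma green_level m n v w : (forall a, 0 < m a) ->
  size w = (size v + n)%N -> green e m v w = trans_iter e m n v w.
Proof.
move=> m0 wn; rewrite /green (@nneseriesD1 _ _ n)//; last first.
  by move=> k _; apply: trans_iter_ge0.
rewrite eseries0 ?adde0// => k _ /andP[_ kn]; apply: trans_iter_size => //.
by rewrite wn eqn_add2l eq_sym.
Qed.

Lemma green_lower m v w : (forall a, 0 < m a) ->
  (size w < size v)%N -> green e m v w = 0%E.
Proof.
move=> m0 wv; rewrite /green eseries0// => k _ _; apply: trans_iter_size => //.
by rewrite ltn_eqF// (leq_trans wv)// leq_addr.
Qed.

Lemma green_nil m w : (forall a, 0 < m a) -> green e m [::] w = (mass m w)%:E.
Proof.
move=> m0; rewrite (@green_level _ (size w))//.
case: (posnP (size w)) => [/size0nil ->|w0]; first by rewrite /mass big_nil.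
rewrite -(prednK w0) trans_iterS// class_walk_nil ?prednK//.
by rewrite mul1r class_mass_nil divr1.
Qed.

Lemma martin_kernel_diag m v : (forall a, 0 < m a) ->
  martin_kernel e m v v = ((mass m v)^-1)%:E.
Proof.
move=> m0; rewrite /martin_kernel green_nil// (@green_level _ 0)//= ?addn0//.
by rewrite eqxx mul1e inver gt_eqF ?mass_gt0.
Qed.

Lemma martin_kernel_not_below m v w : (forall a, 0 < m a) ->
  v != w -> (size w <= size v)%N -> martin_kernel e m v w = 0%E.
Proof.
move=> m0 vw; rewrite /martin_kernel leq_eqVlt => /orP[/eqP wv|wv].
  by rewrite (@green_level _ 0) ?addn0//= (negbTE vw) mul0e.
by rewrite green_lower// mul0e.
Qed.

Lemma martin_kernel_below m n v w : (forall a, 0 < m a) ->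
  size w = (size v + n.+1)%N ->
  martin_kernel e m v w = (class_walk m n v w / class_mass e m v)%:E.
Proof.
move=> m0 wn; have mw : mass m w != 0 by rewrite gt_eqF ?mass_gt0.
have cv : class_mass e m v != 0 by rewrite gt_eqF ?class_mass_gt0.
rewrite /martin_kernel green_nil// (green_level m0 wn) trans_iterS//.
rewrite inver (negbTE mw) -EFinM; congr (_%:E).
by field; rewrite mw cv.
Qed.

(** If w is longer than v, the kernel is a quotient whose numerator is the same
    for m and m'; what remains is the change of denominator. Otherwise w is
    never reached from v and both kernels vanish. *)
Lemma martin_kernel_change_mass m m' v w :
  (forall a, 0 < m a) -> (forall a, 0 < m' a) ->
  (forall x, (exists2 k, k != 0 & forall u, e u x -> mass m' u = k * mass m u)
    \/ (forall u, e u x -> e (parent u) (parent x))) ->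
  v != w ->
  martin_kernel e m v w =
  (martin_kernel e m' v w * (class_mass e m' v / class_mass e m v)%:E)%E.
Proof.
move=> m0 m'0 alt vw; have [wv|vltw] := leqP (size w) (size v).
  by rewrite !martin_kernel_not_below// mul0e.
have wn : size w = (size v + (size w - size v).-1.+1)%N by lia.
have cv : class_mass e m v != 0 by rewrite gt_eqF ?class_mass_gt0.
have cv' : class_mass e m' v != 0 by rewrite gt_eqF ?class_mass_gt0.
rewrite (martin_kernel_below m0 wn) (martin_kernel_below m'0 wn).
rewrite (class_walk_indep _ _ _ m0 m'0 alt) -EFinM; congr (_%:E).
by field; rewrite cv cv'.
Qed.

End Kernel.

(** * The iterated function system *)

Lemma sim_size (R : realType) (d N : nat) (S : 'I_N -> 'rV[R]_d -> 'rV[R]_d)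
  (K : set 'rV[R]_d) v w : sim S K v w -> size v = size w.
Proof. by case/orP => [/eqP ->|/and3P[/eqP]]. Qed.

Theorem theorem3 (R : realType) (d N : nat) (D : set 'rV[R]_d)
    (c : 'I_N -> R) (S : 'I_N -> 'rV[R]_d -> 'rV[R]_d) (K : set 'rV[R]_d)
    (m : 'I_N -> R)
    (hS : ifs D c S)
    (hK : attractor D S K)
    (hKc : connected K)
    (hO : open_set_condition D c S)
    (hm : mass_distribution m)
    (hequiv : equivalence_rel (sim S K))
    (hhom : martin_kernel_exists (sim S K) (@uniform_mass R N))
    (halt : forall w : seq 'I_N,
        (forall w', sim S K w' w -> mass m w = mass m w') \/
        (forall w', sim S K w' w -> sim S K (parent w) (parent w'))) :
  forall v w : seq 'I_N,
    martin_kernel (sim S K) m v w =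
    if v == w then ((mass m v)^-1)%:E
    else (martin_kernel (sim S K) (@uniform_mass R N) v w *
          ((nb_sim (sim S K) v)%:R * N%:R ^- size v
             / class_mass (sim S K) m v)%:E)%E.
Proof.
have m0 a : 0 < m a by case: hm => /(_ a) /andP[].
have u0 a : 0 < @uniform_mass R N a.
  (* the letter a itself shows that the alphabet is not empty *)
  by rewrite invr_gt0 ltr0n (leq_ltn_trans _ (ltn_ord a)).
have e_size := @sim_size R d N S K.
move=> v w; case: eqVneq => [<-|vw]; first exact: martin_kernel_diag.
rewrite -class_mass_uniform//; apply: martin_kernel_change_mass => // x.
have [mc|par] := halt x; [left|right].
  exists (mass (@uniform_mass R N) x / mass m x).
    by rewrite gt_eqF// divr_gt0 ?mass_gt0.
  move=> u eux; rewrite -(mc _ eux) divfK ?gt_eqF ?mass_gt0//.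
  by rewrite !mass_uniform (e_size _ _ eux).
move=> u /par epxu.
by case: (hequiv (parent x) (parent u) (parent x)) => + /(_ epxu) <-.
Qed.
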